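(* Let $n\ge 2$, $\alpha\in(0,1)$ and $\rho\in\{\mathrm{VaR},\mathrm{ES}\}$, and let $\mathbf X=(X_1,\dots,X_n)$ be in $(L^0)^n$ when $\rho=\mathrm{VaR}$ and in $(L^1)^n$ when $\rho=\mathrm{ES}$. Then $\mathrm{DQ}^\rho_\alpha(\mathbf X)=0$ if and only if $\sum_{i=1}^nX_i\le\sum_{i=1}^n\rho_\alpha(X_i)$ almost surely. In particular, if $\sum_{i=1}^nX_i$ is almost surely constant, then $\mathrm{DQ}^{\mathrm{ES}}_\alpha(\mathbf X)=0$, and $\mathrm{DQ}^{\mathrm{VaR}}_\alpha(\mathbf X)=0$ provided $\alpha<1/n$.
   Context: Let $(\Omega,\mathcal F,\mathbb P)$ be an atomless probability space. $L^0$ is the set of all random variables and $L^1$ the set of integrable random variables; a.s. equal random variables are identified. For $\alpha\in[0,1)$ and $X\in L^0$, $\mathrm{VaR}_\alpha(X)=\inf\{x\in\mathbb R:\mathbb P(X\le x)\ge 1-\alpha\}$; in particular $\mathrm{VaR}_0(X)=\operatorname{ess\,sup}X$, possibly $+\infty$. For $\alpha\in(0,1)$ and $X\in L^1$, $\mathrm{ES}_\alpha(X)=\frac1\alpha\int_0^\alpha\mathrm{VaR}_\beta(X)\,\mathrm d\beta$, and $\mathrm{ES}_0(X)=\operatorname{ess\,sup}X$. For $\rho\in\{\mathrm{VaR},\mathrm{ES}\}$, $\alpha\in(0,1)$ and $\mathbf X=(X_1,\dots,X_n)$ (in $(L^0)^n$ when $\rho=\mathrm{VaR}$, in $(L^1)^n$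 when $\rho=\mathrm{ES}$), the diversification quotient is $\mathrm{DQ}^\rho_\alpha(\mathbf X)=\alpha^*/\alpha$, where $\alpha^*=\inf\{\beta\in(0,1):\rho_\beta(\sum_{i=1}^nX_i)\le\sum_{i=1}^n\rho_\alpha(X_i)\}$, with the convention $\inf\emptyset=1$. *)

(* Defs.v *)
From HB Require Import structures.
From mathcomp Require Import all_boot all_order all_algebra.
From mathcomp Require Import all_classical all_reals all_analysis ess_sup_inf.
Set Implicit Arguments. Unset Strict Implicit. Unset Printing Implicit Defensive.
Import Order.TTheory GRing.Theory Num.Theory.
Import numFieldNormedType.Exports.
Local Open Scope classical_set_scope.
Local Open Scope ring_scope.

Section Defs.
Context {d : measure_display} {T : measurableType d} {R : realType}.
Variable P : probability T R.

Definition atomless : Prop :=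
  forall A : set T, measurable A -> (0 < P A)%E ->
    exists B : set T, [/\ measurable B, B `<=` A, (0 < P B)%E & (P B < P A)%E].

(* VaR_a(X) = inf {x in R : P(X <= x) >= 1 - a}, valued in \bar R (inf of empty = +oo) *)
Definition VaR (a : R) (X : T -> R) : \bar R :=
  ereal_inf [set x%:E | x in [set x : R | ((1 - a)%:E <= P [set w | (X w <= x)%R])%E]].

Definition ES (a : R) (X : T -> R) : \bar R :=
  if a == 0 then ess_sup P (EFin \o X)
  else ((a^-1)%:E * \int[lebesgue_measure]_(b in `[0%R, a]) VaR b X)%E.

Inductive risk_measure := rmVaR | rmES.

Definition rho (r : risk_measure) : R -> (T -> R) -> \bar R :=
  match r with rmVaR => VaR | rmES => ES end.

Definition admissible (r : risk_measure) (X : T -> R) : Prop :=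
  match r with
  | rmVaR => measurable_fun [set: T] X
  | rmES => P.-integrable [set: T] (EFin \o X)
  end.

Definition alpha_star (r : risk_measure) (n : nat) (a : R) (X : 'I_n -> T -> R) : R :=
  let E := [set b : R | 0 < b < 1 /\
             (rho r b (fun w => (\sum_(i < n) X i w)%R) <= \sum_(i < n) rho r a (X i))%E] in
  if pselect (E = set0) then 1 else inf E.

Definition DQ (r : risk_measure) (n : nat) (a : R) (X : 'I_n -> T -> R) : R :=
  alpha_star r a X / a.

End Defs.

(* Main.v *)
Require Import Defs.
From HB Require Import structures.
From mathcomp Require Import all_boot all_order all_algebra.
From mathcomp Require Import all_classical all_reals all_analysis ess_sup_inf.
From mathcomp Require Import measurable_realfun lra.
Import Order.TTheory GRing.Theory Num.Theory.
Import numFieldNormedType.Exports.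
Local Open Scope classical_set_scope.
Local Open Scope ring_scope.

(** Write [S] for the sum and [c] for the sum of the [rho_a (X_i)]. For
    [0 < b < 1], [VaR_b S <= rho_b S], and [VaR_b S <= c] gives
    [P (S <= c) >= 1 - b]; so if the infimum defining [a^*] is [0], letting
    [b] tend to [0] gives [P (S <= c) = 1]. Conversely, if [S <= c] almost
    surely then [rho_b S <= c] for every [b] in (0,1).
    If [S] is a.s. constant, equal to [k], it remains to see that [k <= c]. For
    ES this follows from [E X <= ES_a X]. For VaR, the events
    [X_i > VaR_a (X_i)] have probability at most [a < 1/n], hence do not cover
    the space, and on the complement of their union [S <= c]. *)

(** * Measurability and comparison of extended-real integrals *)

(** The preimage of each ray []r, +oo]] is closed downwards, hence an interval. *)
Lemma nonincreasing_emeasurable {R : realType} (f : R -> \bar R) :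
  {homo f : x y / x <= y >-> (y <= x)%E} -> measurable_fun [set: R] f.
Proof.
move=> f_ni.
apply: (measurability _ (ErealGenOInfty.measurableE R)) => _ [_ [r ->] <-].
rewrite setTI; apply: is_interval_measurable => s t /=.
rewrite !in_itv/= !andbT => _ rft u /andP[_ ut].
by rewrite in_itv/= andbT (lt_le_trans rft)// f_ni.
Qed.

(** Integrability is not required: the integrals may be infinite, with the
    convention [+oo - oo = -oo]. *)
Lemma measurable_le_integral {d : measure_display} {T : measurableType d}
  {R : realType} (mu : {measure set T -> \bar R}) (D : set T) (f g : T -> \bar R) :
  measurable D -> measurable_fun D f -> measurable_fun D g ->
  (forall x, D x -> (f x <= g x)%E) ->
  (\int[mu]_(x in D) f x <= \int[mu]_(x in D) g x)%E.
Proof.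
move=> mD mf mg fg.
have fg' : {in D, forall x, (f x <= g x)%E} by move=> x /[!inE]; exact: fg.
rewrite integralE [leRHS]integralE leeB// ge0_le_integral//.
- exact: measurable_funepos.
- exact: measurable_funepos.
- by move=> x Dx; apply: (funepos_le fg'); rewrite inE.
- exact: measurable_funeneg.
- exact: measurable_funeneg.
- by move=> x Dx; apply: (funeneg_le fg'); rewrite inE.
Qed.

Lemma integral_cst_itv0 {R : realType} (b c : R) : 0 < b ->
  (\int[lebesgue_measure]_(x in `[0%R, b]) c%:E = b%:E * c%:E)%E.
Proof.
move=> b0; rewrite muleC integral_cst//=.
by rewrite lebesgue_measure_itv/= lte_fin b0 oppr0 adde0.
Qed.

(** * Quantiles and Expected Shortfall of one random variable *)

Section quantiles.
Context {d : measure_display} {T : measurableType d} {R : realType}.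
Variables (P : probability T R) (X : T -> R).
Hypothesis mX : measurable_fun [set: T] X.

#[local] HB.instance Definition _ := @isMeasurableFun.Build _ _ _ _ X mX.

Let F := cdf (X : {RV P >-> R}).

Let cdfE x : F x = P [set w | X w <= x].
Proof. by rewrite /F /cdf -set_itvE /distribution /pushforward. Qed.

Lemma VaR_nonincreasing : {homo (fun b => VaR P b X) : x y / x <= y >-> (y <= x)%E}.
Proof.
move=> x y xy; apply: ereal_inf_le_tmp => _ [z Pz <-]; exists z => //=.
by apply: le_trans Pz; rewrite lee_fin lerB.
Qed.

(** The infimum is attained: each [y > x] exceeds some [z] with [P (X <= z) >= 1 - b], and right
    continuity of the distribution function lets [y] decrease to [x]. *)
Lemma VaR_le (b x : R) :
  (VaR P b X <= x%:E)%E = ((1 - b)%:E <= P [set w | (X w <= x)%R])%E.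
Proof.
apply/idP/idP => [VX|Px]; last first.
  by apply: ereal_inf_lbound; exists x.
rewrite -cdfE; apply: (cvge_to_ge (@cdf_right_continuous _ _ _ P X x)).
near=> y.
have /ereal_inf_lt[_ [z Pz <-]] : (VaR P b X < y%:E)%E.
  by rewrite (le_lt_trans VX)// lte_fin; near: y; exact: nbhs_right_gt.
rewrite lte_fin => /ltW zy.
by rewrite (le_trans Pz)//= -cdfE cdf_nondecreasing.
Unshelve. all: by end_near. Qed.

(** Otherwise the distribution function would stay above [1 - b > 0], against its limit [0] at
    [-oo]. The next lemma uses the limit [1] at [+oo] in the same way. *)
Lemma VaR_gtNy (b : R) : b < 1 -> (-oo < VaR P b X)%E.
Proof.
move=> b1; rewrite ltNge leeNy_eq; apply/negP => /eqP V.
have /(cvge_to_ge (@cvg_cdfNy0 _ _ _ P X)) : \forall x \near -oo, ((1 - b)%:E <= F x)%E.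
  by near=> x; rewrite cdfE -VaR_le V leNye.
by rewrite lee_fin leNgt subr_gt0 b1.
Unshelve. all: by end_near. Qed.

Lemma VaR_lty (b : R) : 0 < b -> (VaR P b X < +oo)%E.
Proof.
move=> b0; rewrite ltNge leye_eq; apply/negP => /eqP V.
have /(cvge_to_le (@cvg_cdfy1 _ _ _ P X)) : \forall x \near +oo, (F x <= (1 - b)%:E)%E.
  by near=> x; rewrite cdfE ltW// ltNge -VaR_le V.
by rewrite lee_fin leNgt ltrBlDr ltrDl b0.
Unshelve. all: by end_near. Qed.

Lemma VaR_fin_num (b : R) : 0 < b < 1 -> VaR P b X \is a fin_num.
Proof.
by move=> /andP[b0 b1]; rewrite fin_numE -ltNye -ltey VaR_gtNy ?VaR_lty.
Qed.

Lemma measurable_VaR (D : set R) : measurable_fun D (fun b => VaR P b X).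
Proof. apply: measurable_funTS; exact: nonincreasing_emeasurable VaR_nonincreasing. Qed.

(** The bound [c] is extended because it will be a sum of risk measures of merely measurable
    variables, where Expected Shortfall may be infinite. *)
Lemma le_probability_VaR (b : R) (c : \bar R) : 0 <= b < 1 -> (VaR P b X <= c)%E ->
  ((1 - b)%:E <= P [set w | (X w)%:E <= c]%E)%E.
Proof.
move=> /andP[b0 b1]; case: c => [x| |].
- by rewrite VaR_le.
- have -> : [set w | (X w)%:E <= +oo]%E = setT.
    by apply/seteqP; split => w //= _; rewrite leey.
  by rewrite probability_setT lee_fin gerBl.
- by rewrite leeNy_eq => /eqP V; have := VaR_gtNy b b1; rewrite V ltxx.
Qed.

Lemma VaR_le_prob1 (b : R) (c : \bar R) : 0 <= b ->
  P [set w | (X w)%:E <= c]%E = 1%E -> (VaR P b X <= c)%E.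
Proof.
move=> b0; case: c => [x Px| |].
- by rewrite VaR_le [leRHS]Px lee_fin gerBl.
- by rewrite leey.
(* For [c = -oo] the event is empty, [X] being real valued, so it cannot have probability one. *)
- rewrite (_ : [set _ | _] = set0) ?measure0.
    by move=> /eqP; rewrite eq_sym onee_eq0.
  by apply/seteqP; split.
Qed.

(** [ES] averages [VaR] over levels at most [b], where it is at least its value at [b]. *)
Lemma VaR_le_ES (b : R) : 0 < b < 1 -> (VaR P b X <= ES P b X)%E.
Proof.
move=> b01; have /andP[b0 b1] := b01; rewrite /ES gt_eqF//.
rewrite lee_pdivlMl// -(fineK (VaR_fin_num _ b01)) -integral_cst_itv0//.
apply: measurable_le_integral => //; first exact: measurable_VaR.
move=> x /=; rewrite in_itv/= fineK ?VaR_fin_num// => /andP[_ xb].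
exact: VaR_nonincreasing.
Qed.

Lemma ES_le_prob1 (b : R) (c : \bar R) : 0 < b ->
  P [set w | (X w)%:E <= c]%E = 1%E -> (ES P b X <= c)%E.
Proof.
move=> b0 Xc; rewrite /ES gt_eqF// lee_pdivrMl//.
have Vc x : 0 <= x -> (VaR P x X <= c)%E by move=> x0; exact: VaR_le_prob1.
case: c Xc Vc => [c _ Vc|_ _|Xc _].
- rewrite -integral_cst_itv0//.
  apply: measurable_le_integral => //; first exact: measurable_VaR.
  by move=> x /=; rewrite in_itv/= => /andP[x0 _]; exact: Vc.
- by rewrite gt0_muley ?lte_fin// leey.
- move: Xc; rewrite (_ : [set _ | _] = set0) ?measure0.
    by move=> /eqP; rewrite eq_sym onee_eq0.
  by apply/seteqP; split.
Qed.

(** * Expectation against Expected Shortfall *)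

(** The set on the left is the interval ]0, P(X > x)[, since [VaR_u X > x] iff
    [u < P (X > x)]. *)
Lemma uniform_prob_VaR_gt (b x : R) : 0 < b < 1 -> (VaR P b X <= x%:E)%E ->
  uniform_prob (@ltr01 R) [set u | 0 < u < b /\ (x%:E < VaR P u X)%E] =
  P [set w | x < X w].
Proof.
move=> /andP[b0 b1]; rewrite VaR_le -cdfE => bF.
have mFx : measurable [set w | X w <= x].
  by rewrite -[X in measurable X]setTI; exact: measurable_fun_le.
have Fx : F x \is a fin_num by rewrite cdfE fin_num_measure.
set p := 1 - fine (F x).
have pE : P [set w | x < X w] = p%:E.
  have -> : [set w | x < X w] = ~` [set w | X w <= x].
    by apply/seteqP; split => w /=; rewrite ltNge => /negP.
  by rewrite probability_setC// -cdfE EFinB fineK.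
(* Thanks to [VaR_b X <= x], the restriction [u < b] cuts nothing off []0, p[]. *)
have pb : p <= b.
  by move: bF; rewrite -(fineK Fx) lee_fin /p lerBlDr lerBlDl.
have p0 : 0 <= p by rewrite -lee_fin -pE.
have VuE u : (x%:E < VaR P u X)%E = (u < p).
  rewrite ltNge VaR_le -cdfE -ltNge -(fineK Fx) lte_fin /p.
  by rewrite ltrBrDr addrC -ltrBrDr.
have -> : [set u | 0 < u < b /\ (x%:E < VaR P u X)%E] = `]0, p[%classic.
  apply/seteqP; split => u /=; rewrite in_itv/= VuE; first by case=> /andP[-> _].
  by move=> /andP[-> up]; rewrite up (lt_le_trans up pb).
rewrite pE /uniform_prob (eq_integral (cst 1%E)).
  rewrite integral_cst//= mul1e lebesgue_measure_itv/= lte_fin oppr0 adde0.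
  by case: ltP => // p0'; congr EFin; apply/eqP; rewrite eq_le p0 p0'.
move=> u; rewrite inE/= in_itv/= => /andP[u0 up].
rewrite /uniform_pdf (ltW u0) subr0 invr1 ifT//.
by rewrite (le_trans (ltW up))// (le_trans pb)// ltW.
Qed.

(** With [q = VaR_b X], [(X - q)^+] under [P] and [(VaR_u X - q) 1_{0 < u < b}]
    under the uniform law have the same tails, hence the same expectation [e], so
    that [ES_b X >= q + e / b >= q + e >= E X]. *)
Lemma expectation_le_ES (b : R) : 0 < b < 1 -> P.-integrable [set: T] (EFin \o X) ->
  (\int[P]_w (X w)%:E <= ES P b X)%E.
Proof.
move=> b01 iX; have /andP[b0 b1] := b01.
have vfin := VaR_fin_num b b01.
set q := fine (VaR P b X).
have qE : VaR P b X = q%:E by rewrite fineK.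
pose Y w := Num.max (X w - q) 0.
(* Open at [0]: [VaR_0 X] may be [+oo], which [fine] sends to [0], and [Z] could then be
   negative. *)
pose A : set R := [set` `]0, b[].
pose Z u := (fine (VaR P u X) - q) * \1_A u.
have Y0 w : 0 <= Y w by rewrite le_max lexx orbT.
have Vq u : u <= b -> (q%:E <= VaR P u X)%E.
  by move=> ub; rewrite -qE; exact: VaR_nonincreasing.
have ZE u : 0 < u < b -> (Z u + q)%:E = VaR P u X.
  move=> ub; rewrite /Z indicE mem_set ?mulr1 ?subrK; last by rewrite /A/= in_itv.
  rewrite fineK//.
  by rewrite VaR_fin_num//; case/andP: ub => -> /lt_trans ->.
have Z_out u : ~~ (0 < u < b) -> Z u = 0.
  by move=> ub; rewrite /Z indicE memNset ?mulr0// /A/= in_itv/=; exact/negP.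
have Z0 u : 0 <= Z u.
  have [ub|/Z_out->//] := boolP (0 < u < b).
  rewrite -(lerD2r q) add0r -lee_fin ZE// Vq//.
  by case/andP: ub => _ /ltW.
have mY : measurable_fun setT Y.
  by apply: measurable_maxr => //; exact: measurable_funB.
have mZ : measurable_fun setT Z.
  apply: measurable_funM; last by apply: measurable_indic; exact: measurable_itv.
  by apply: measurable_funB => //; apply: measurableT_comp => //; exact: measurable_VaR.
pose U : probability (measurableTypeR R) R := uniform_prob (@ltr01 R).
pose YRV : {RV P >-> R} := mfun_Sub (mem_set mY).
pose ZRV : {RV U >-> R} := @mfun_Sub _ _ (measurableTypeR R) R Z (mem_set mZ).
(* Both expectations are integrals of tail probabilities over [t >= 0]; there [t + q >= VaR_b X], as
   the tail identity requires. *)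
have EYZ : (\int[P]_w (Y w)%:E = \int[U]_u (Z u)%:E)%E.
  transitivity 'E_P[YRV]%E; first by rewrite unlock.
  transitivity 'E_U[ZRV]%E; last by rewrite unlock.
  rewrite !ge0_expectation_ccdf//; apply: eq_integral => t.
  rewrite inE/= in_itv/= andbT => t0.
  rewrite /ccdf /distribution /pushforward.
  transitivity (P [set w | t + q < X w]).
    congr (P _); apply/seteqP; split => w /=; rewrite in_itv/= andbT /Y lt_max.
      by rewrite ltrBrDr (ltNge t 0) t0 orbF.
    by rewrite ltrBrDr => ->.
  rewrite -(@uniform_prob_VaR_gt b)//; last by rewrite qE lee_fin lerDr.
  congr (uniform_prob _ _); apply/seteqP; split => u /=; rewrite in_itv/= andbT.
    by move=> [ub]; rewrite -ZE// lte_fin ltrD2r.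
  have [ub|/Z_out->] := boolP (0 < u < b).
    by rewrite -ZE// lte_fin ltrD2r.
  by rewrite ltNge t0.
(* The uniform law has density [1] on [[0, 1]], and [Z] vanishes off []0, b[]. *)
have EZ : (\int[U]_u (Z u)%:E = \int[lebesgue_measure]_(u in `[0%R, b]) (Z u)%:E)%E.
  rewrite integral_uniform//; last exact/measurable_EFinP.
  rewrite subr0 invr1 mul1e integral_mkcond [RHS]integral_mkcond.
  apply: eq_integral => u _; rewrite !patchE.
  have [/andP[u0 ub]|/Z_out->] := boolP (0 < u < b); last by do 2 case: ifP.
  rewrite !mem_set//= in_itv/= ?(ltW u0)//= ?(ltW ub)//.
  by rewrite (ltW (lt_trans ub b1)).
(* [Y] is the positive part of the integrable variable [X - q], so [e] below is a real number. *)
have iY : P.-integrable setT (EFin \o Y).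
  have -> : EFin \o Y = ((fun w => (X w)%:E - q%:E)^\+)%E.
    by apply/funext => w; rewrite /Y funeposE /= EFin_max EFinB.
  apply: integrable_funepos => //; apply: integrableB => //.
  exact: finite_measure_integrable_cst.
have Yfin : (\int[P]_w (Y w)%:E)%E \is a fin_num by exact: integrable_fin_num.
set e := fine (\int[P]_w (Y w)%:E)%E.
have eE : (\int[P]_w (Y w)%:E)%E = e%:E by rewrite fineK.
have e0 : 0 <= e by rewrite -lee_fin -eE; apply: integral_ge0 => w _; rewrite lee_fin.
have EX : (\int[P]_w (X w)%:E <= (q + e)%:E)%E.
  apply: (@le_trans _ _ (\int[P]_w (q%:E + (Y w)%:E))%E).
    apply: measurable_le_integral => //.
    - exact/measurable_EFinP.
    - by apply: emeasurable_funD => //; exact/measurable_EFinP.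
    - by move=> w _; rewrite -EFinD lee_fin -lerBlDl le_max lexx.
  rewrite integralD//; last exact: finite_measure_integrable_cst.
  rewrite integral_cst// [X in (_ * X + _)%E](_ : _ = 1%E); last exact: probability_setT.
  by rewrite mule1 eE EFinD.
apply: (le_trans EX).
rewrite /ES gt_eqF// lee_pdivlMl//.
apply: (@le_trans _ _ (\int[lebesgue_measure]_(u in `[0%R, b]) (q%:E + (Z u)%:E))%E).
  rewrite integralD//=; last 2 first.
  - apply/integrableP; split => //.
    by rewrite integral_cst_itv0//= -EFinM ltry.
  (* The integral of [Z] is finite because it equals that of [Y]. *)
  - apply/integrableP; split; first by apply/measurable_EFinP; exact: measurable_funTS.
    under eq_integral do rewrite gee0_abs ?lee_fin//.
    by rewrite -EZ -EYZ eE ltry.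
  (* What remains is [b * e <= e], from [b < 1] and [e >= 0]. *)
  rewrite integral_cst_itv0// -EZ -EYZ eE -!EFinM -EFinD lee_fin mulrDr lerD2l.
  by rewrite ler_piMl// ltW.
apply: measurable_le_integral => //.
- apply: emeasurable_funD => //.
  by apply/measurable_EFinP; exact: measurable_funTS.
- exact: measurable_VaR.
move=> u /=; rewrite in_itv/= => /andP[u0 ub].
(* Inside []0, b[] this is an equality; at the end points [Z] is [0] and [q <= VaR_u X] suffices. *)
have [uu|/Z_out->] := boolP (0 < u < b); first by rewrite -ZE// addrC EFinD.
by rewrite adde0 Vq.
Qed.

End quantiles.

(** * Union bound and vanishing of the diversification quotient *)

Lemma measure_bigsetU_le {d : measure_display} {T : measurableType d} {R : realType}
  (mu : {measure set T -> \bar R}) (I : Type) (s : seq I) (A : I -> set T) :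
  (forall i, measurable (A i)) ->
  (mu (\big[setU/set0]_(i <- s) A i) <= \sum_(i <- s) mu (A i))%E.
Proof.
move=> mA; elim: s => [|i s IH]; first by rewrite !big_nil measure0.
rewrite !big_cons (le_trans (measureU2 _ _ _))//; last exact: leeD2l.
exact: bigsetU_measurable.
Qed.

Section diversification_quotient.
Context {d : measure_display} {T : measurableType d} {R : realType}.
Variable P : probability T R.

Lemma VaR_le_rho (r : risk_measure) (b : R) (X : T -> R) :
  measurable_fun [set: T] X -> 0 < b < 1 -> (VaR P b X <= rho P r b X)%E.
Proof. by case: r => //= mX b01; exact: VaR_le_ES. Qed.

Lemma rho_le_prob1 (r : risk_measure) (b : R) (X : T -> R) (c : \bar R) :
  measurable_fun [set: T] X -> 0 < b ->
  P [set w | (X w)%:E <= c]%E = 1%E -> (rho P r b X <= c)%E.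
Proof.
case: r => /= mX b0; last exact: ES_le_prob1.
by apply: VaR_le_prob1 => //; exact: ltW.
Qed.

Lemma admissible_measurable (r : risk_measure) (X : T -> R) :
  admissible P r X -> measurable_fun [set: T] X.
Proof. by case: r => //= /measurable_int/measurable_EFinP. Qed.

Lemma measurable_le_level (X : T -> R) (c : \bar R) :
  measurable_fun [set: T] X -> measurable [set w | (X w)%:E <= c]%E.
Proof.
move=> mX; rewrite -[X in measurable X]setTI.
by apply: emeasurable_fun_infty_c => //; exact/measurable_EFinP.
Qed.

Lemma ae_le_probability (X : T -> R) (c : \bar R) : measurable_fun [set: T] X ->
  {ae P, forall w, ((X w)%:E <= c)%E} <-> P [set w | (X w)%:E <= c]%E = 1%E.
Proof.
move=> mX; have mA := measurable_le_level X c mX.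
have H : {ae P, forall w, ((X w)%:E <= c)%E} <->
    P (~` [set w | (X w)%:E <= c]%E) = 0%E by exact: negligibleP (measurableC mA).
rewrite H probability_setC//; split=> [/eqP|->]; last by rewrite subee.
by rewrite sube_eq ?fin_num_measure ?add0e// => /eqP.
Qed.

Lemma DQ_eq0 (r : risk_measure) (n : nat) (a : R) (X : 'I_n -> T -> R) :
  0 < a -> (forall i, measurable_fun [set: T] (X i)) ->
  DQ P r a X = 0 <->
  {ae P, forall w, ((\sum_(i < n) X i w)%:E <= \sum_(i < n) rho P r a (X i))%E}.
Proof.
move=> a0 mX; set c := (\sum_(i < n) _)%E.
pose S w := \sum_(i < n) X i w.
have mS : measurable_fun setT S by exact: measurable_sum.
rewrite (ae_le_probability S c mS) /DQ /alpha_star /=.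
set E := [set b : R | _].
have E_lb : lbound E 0 by move=> b [/andP[/ltW]].
split=> [/eqP|PS].
  rewrite mulf_eq0 invr_eq0 (gt_eqF a0) orbF.
  (* If [E] were empty, the convention would give [alpha_star = 1], not [0]. *)
  case: pselect => [E0|EN0] /=; first by rewrite oner_eq0.
  have /set0P E0 : E != set0 by exact/eqP.
  move=> /eqP infE.
  apply/eqP; rewrite eq_le probability_le1/=; last exact: measurable_le_level.
  apply/lee_addgt0Pr => e e0.
  have [||b [/andP[b0 b1] Sb] be] := @inf_lt _ E e => //; first by rewrite infE.
  rewrite -leeBlDr// -EFinB (@le_trans _ _ (1 - b)%:E)//.
    by rewrite lee_fin lerB// ltW.
  apply: le_probability_VaR => //; first by rewrite ltW.
  by apply: le_trans Sb; rewrite VaR_le_rho ?b0.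
have EE (b : R) : 0 < b < 1 -> E b.
  by move=> b01; split=> //; apply: rho_le_prob1 => //; case/andP: b01.
case: pselect => [E0|EN0] /=.
  by have := EE 2^-1; rewrite E0 => /(_ ltac:(lra)).
have Eh : E 2^-1 by apply: EE; lra.
suff -> : inf E = 0 by rewrite mul0r.
apply/eqP; rewrite eq_le lb_le_inf//= ?andbT; last by exists 2^-1.
apply/ler_addgt0Pr => e e0; rewrite add0r.
(* The minimum with [1/2] keeps the level inside []0, 1[] when [e] is large. *)
have : inf E <= Num.min e 2^-1.
  apply: ge_inf; first by exists 0.
  by apply: EE; rewrite lt_min e0/= gt_min; apply/andP; split; [lra | apply/orP; right; lra].
by rewrite le_min => /andP[].
Qed.

(** By linearity, [k] is the sum of the expectations of the [X_i]. *)
Lemma cst_le_sum_ES (n : nat) (a k : R) (X : 'I_n -> T -> R) : 0 < a < 1 ->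
  (forall i, P.-integrable [set: T] (EFin \o X i)) ->
  {ae P, forall w, \sum_(i < n) X i w = k} ->
  (k%:E <= \sum_(i < n) ES P a (X i))%E.
Proof.
move=> a01 iX Sk.
have mX i : measurable_fun setT (X i) by have /measurable_int/measurable_EFinP := iX i.
apply: (@le_trans _ _ (\sum_(i < n) \int[P]_w (X i w)%:E)%E); last first.
  by apply: lee_sum => i _; exact: expectation_le_ES.
rewrite -integral_sum//.
under eq_integral do rewrite sumEFin.
rewrite (@ae_eq_integral _ _ _ P setT (cst k%:E))//.
- rewrite integral_cst// [X in (_ * X)%E](_ : _ = 1%E); last exact: probability_setT.
  by rewrite mule1.
- by apply/measurable_EFinP; exact: measurable_sum.
- by apply: filterS Sk => w Sw _; rewrite Sw.
Qed.

Lemma cst_le_sum_VaR (n : nat) (a k : R) (X : 'I_n -> T -> R) : 0 < a < 1 ->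
  a < n%:R^-1 -> (forall i, measurable_fun [set: T] (X i)) ->
  {ae P, forall w, \sum_(i < n) X i w = k} ->
  (k%:E <= \sum_(i < n) VaR P a (X i))%E.
Proof.
move=> a01 an mX [N [mN PN0 SN]]; have /andP[a0 a1] := a01.
(* Positivity of [n] comes from [0 < a < n^-1]. *)
have n0 : 0 < n%:R :> R by rewrite -invr_gt0 (lt_trans a0).
rewrite leNgt; apply/negP => Vk.
pose A i := ~` [set w | (X i w)%:E <= VaR P a (X i)]%E.
have mA i : measurable (A i) by apply: measurableC; exact: measurable_le_level.
have PA i : (P (A i) <= a%:E)%E.
  have mB := measurable_le_level (X i) (VaR P a (X i)) (mX i).
  rewrite probability_setC//.
  have /= := le_probability_VaR P (X i) (mX i) a (VaR P a (X i)).
  rewrite (ltW a0) a1 => /(_ isT (lexx _)).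
  by rewrite EFinB !leeBlDr ?fin_num_measure// addeC.
(* At a point outside [N] and every [A i], [k] would be at most the sum of the [VaR_a (X_i)],
   against [Vk]. *)
have cover : [set: T] `<=` N `|` \big[setU/set0]_(i < n) A i.
  move=> w _; have [Sw|/SN] := pselect (\sum_(i < n) X i w = k); last by left.
  right; rewrite -bigcup_seq/=; apply: contrapT => nA.
  move: Vk; rewrite -Sw -sumEFin ltNge => /negP; apply; apply: lee_sum => i _.
  by apply: contrapT => Xi; apply: nA; exists i => //=; rewrite mem_index_enum.
(* The union bound gives [1 <= n * a], contradicting [a < 1/n]. *)
have : (P [set: T] <= (n%:R * a)%:E)%E.
  apply: (@le_trans _ _ (P N + \sum_(i < n) P (A i))%E); last first.
    rewrite PN0 add0e (le_trans (lee_sum _ (fun i _ => PA i)))//.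
    by rewrite sumEFin sumr_const card_ord mulr_natl.
  have mB : measurable (\big[setU/set0]_(i < n) A i) by exact: bigsetU_measurable.
  apply: (@le_trans _ _ (P (N `|` \big[setU/set0]_(i < n) A i))).
    by apply: le_measure; rewrite ?inE//; exact: measurableU.
  apply: (@le_trans _ _ (P N + P (\big[setU/set0]_(i < n) A i))%E).
    exact: measureU2.
  by apply: leeD2l; exact: measure_bigsetU_le.
rewrite probability_setT lee_fin leNgt => /negP; apply.
by rewrite mulrC -ltr_pdivlMr// div1r.
Qed.

End diversification_quotient.

Theorem theorem1 (d : measure_display) (T : measurableType d) (R : realType)
  (P : probability T R) (n : nat) (a : R) :
  atomless P -> (2 <= n)%N -> 0 < a < 1 ->
  (forall (r : risk_measure) (X : 'I_n -> T -> R),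
     (forall i, admissible P r (X i)) ->
     (DQ P r a X = 0 <->
      {ae P, forall w, ((\sum_(i < n) X i w)%:E <= \sum_(i < n) rho P r a (X i))%E}))
  /\
  (forall X : 'I_n -> T -> R,
     (exists c : R, {ae P, forall w, \sum_(i < n) X i w = c}) ->
     ((forall i, admissible P rmES (X i)) -> DQ P rmES a X = 0) /\
     ((forall i, admissible P rmVaR (X i)) -> a < n%:R^-1 -> DQ P rmVaR a X = 0)).
Proof.
move=> _ _ a01; have /andP[a0 a1] := a01.
have DQ0 r (X : 'I_n -> T -> R) : (forall i, admissible P r (X i)) ->
    DQ P r a X = 0 <->
    {ae P, forall w, ((\sum_(i < n) X i w)%:E <= \sum_(i < n) rho P r a (X i))%E}.
  by move=> aX; apply: DQ_eq0 => // i; exact: admissible_measurable (aX i).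
(* Once [k] is at most the sum of the risk measures, almost sure equality to [k] yields the almost
   sure bound of the first part. *)
split=> // X [k Sk]; split=> [aX|aX an]; apply/DQ0 => //.
- have kV := cst_le_sum_ES P n a k X a01 aX Sk.
  by apply: filterS Sk => w ->.
- have kV := cst_le_sum_VaR P n a k X a01 an aX Sk.
  by apply: filterS Sk => w ->.
Qed.
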